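(* Let $k\ge 2$. Then for all sufficiently large $n$, $$N(CM,k,n)\ge\begin{cases} \frac{2n}{k+1} & \text{if } k \text{ is even and } n \text{ is even},\\[2pt] \frac{2n-1}{k+1} & \text{if } k \text{ is even and } n \text{ is odd},\\[2pt] \left\lceil \frac{n}{k}\,\mathsf{d}(k-1,n-1)\right\rceil & \text{if } k \text{ is odd and } n \text{ is even},\\[2pt] \left\lceil \frac{n-1}{2k}\,\mathsf{d}(k-1,n-1)\right\rceil & \text{if } k \text{ is odd and } n \text{ is odd}.\end{cases}$$
   Context: We are given $n$ balls, the set $[n]=\{1,\dots,n\}$, each colored with one of two colors by an unknown coloring. A ball $i$ is a majority ball if more than $n/2$ balls have the same color as $i$. A query is a subset $Q\subseteq[n]$ with $|Q|=k$. In the Counting Model (CM), the answer to a query $Q$ is the number $i\le k/2$ such that $Q$ contains exactly $i$ balls of one of the colors (and $k-i$ of the other); no indication of which color is given. A non-adaptive strategy is a family of queries $Q_1,\dots,Q_q$ fixed in advance. It succeeds if for every coloring, the answers determine the outcome: either every coloring consistent with the answers has no majority ball, or there is a ball that is a majority ball in every coloring consistent with the answers. $N(CM,k,n)$ is the minimum number of queries in a successful non-adaptive strategy. A 2-coloring of a finite set is balanced if the sizes of the two color classes differ by at most one. A hypergraph has Property C if its vertices can be 2-colored so that every edge is balanced. For $k\ge 2$, $\mathsf{d}(k,n)$ denotes the minimum number of edges of a $k$-uniform hypergraph on $n$ vertices that does not have Property C. *)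

(* Defs.v *)
From mathcomp Require Import all_boot.
Set Implicit Arguments. Unset Strict Implicit. Unset Printing Implicit Defensive.

Definition coloring (n : nat) := 'I_n -> bool.

(* Counting Model answer to query Q: the number i <= |Q|/2 such that Q contains
   exactly i balls of one color (= min of the two color counts in Q). *)
Definition cm_answer (n : nat) (c : coloring n) (Q : {set 'I_n}) : nat :=
  minn #|[set x in Q | c x]| #|[set x in Q | ~~ c x]|.

Definition majority_ball (n : nat) (c : coloring n) (i : 'I_n) : Prop :=
  n < 2 * #|[set j | c j == c i]|.

Definition consistent (n : nat) (Qs : seq {set 'I_n}) (c c' : coloring n) : Prop :=
  forall Q, Q \in Qs -> cm_answer c' Q = cm_answer c Q.

(* a non-adaptive strategy (family of queries) succeeds in CM *)
Definition cm_successful (n : nat) (Qs : seq {set 'I_n}) : Prop :=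
  forall c : coloring n,
    (forall c', consistent Qs c c' -> forall i, ~ majority_ball c' i)
    \/ (exists i : 'I_n, forall c', consistent Qs c c' -> majority_ball c' i).

Definition balanced (n : nat) (c : 'I_n -> bool) (E : {set 'I_n}) : bool :=
  let a := #|[set x in E | c x]| in
  let b := #|[set x in E | ~~ c x]| in
  (a <= b.+1) && (b <= a.+1).

Definition uniform (k n : nat) (H : {set {set 'I_n}}) : bool :=
  [forall E in H, #|E| == k].

Definition propertyCb (n : nat) (H : {set {set 'I_n}}) : bool :=
  [exists c : {ffun 'I_n -> bool}, [forall E in H, balanced c E]].

Definition noC (k n : nat) (H : {set {set 'I_n}}) : bool :=
  uniform k H && ~~ propertyCb H.

(* d(k,n): minimum number of edges of a k-uniform hypergraph on n vertices
   without Property C (default 0 if no such hypergraph exists). *)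
Definition dC (k n : nat) : nat :=
  match [pick H : {set {set 'I_n}} | noC k H] with
  | None => 0
  | Some H0 => #|[arg min_(H < H0 | noC k H) #|H|]|
  end.

(* Main.v *)
Require Import Defs.
From mathcomp Require Import all_boot.
From mathcomp Require Import zify.

(**
A coloring is identified with its set [R] of red balls.  For [n] even and
[2|R| = n] there is no majority ball, so no coloring with the same answers may
be unbalanced.  For [n = 2m + 1] and [|R| = m + 1], the ball named by the
strategy is red, and it is blue in every coloring with the same answers and at
most [m] red balls; hence it lies in every set of red balls that can be recolored
without changing an answer.

If [k] is even, such a set is given by a ball in no query, or by two balls whose
only query is the same [Q], when [Q] has [k/2 + 1] red balls.  Thus balls of
degree 0 are rare and essentially every query has at most one ball of degree 1,
and the bound follows by summing degrees.  For [n] odd one unit is missing when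
there is a ball of degree 0, every query has a ball of degree 1 and all other
degrees are 2; then one trades a ball [e] of degree 2 against the degree 1 balls
of its two queries.

If [k] is odd, a ball [x] can be recolored as soon as the sets [Q - x], [Q]
containing [x], are balanced, which can be arranged when there are fewer than
[d(k-1, n-1)] of them.  Since [d(k-1, n-1)] is bounded independently of [n], for
large [n] enough balls remain free to prescribe [|R|].  For [n] odd the argument
applies to two balls at once, giving [deg x + deg y >= d(k-1, n-1)].
*)

Set Implicit Arguments. Unset Strict Implicit. Unset Printing Implicit Defensive.

(** * Sets with prescribed size and trace *)

Lemma intermediate_set (T : finType) (A B : {set T}) r :
  A \subset B -> #|A| <= r <= #|B| ->
  exists C : {set T}, [/\ A \subset C, C \subset B & #|C| = r].
Proof.
move=> sAB; elim: r => [|r IHr] /andP[lAr lrB].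
  by exists A; split=> //; apply/eqP; rewrite -leqn0.
case: (ltnP #|A| r.+1) => [ltAr|geAr]; last first.
  by exists A; split=> //; apply/eqP; rewrite eqn_leq lAr.
have [C [sAC sCB cC]] : exists C : {set T}, [/\ A \subset C, C \subset B & #|C| = r].
  by apply: IHr; rewrite -ltnS ltAr ltnW.
have [x xB xC] : exists2 x, x \in B & x \notin C.
  apply/subsetPn/negP => /subset_leq_card; rewrite cC => le_Br.
  by have := leq_trans lrB le_Br; rewrite ltnn.
exists (x |: C); split; first exact: subset_trans sAC (subsetUr _ _).
  by rewrite subUset sub1set xB.
by rewrite cardsU1 xC cC.
Qed.

Lemma subset_of_card (T : finType) (B : {set T}) r :
  r <= #|B| -> exists2 C : {set T}, C \subset B & #|C| = r.
Proof.
move=> lr; have [|C [_ sC cC]] := @intermediate_set _ set0 B r (sub0set _).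
  by rewrite cards0.
by exists C.
Qed.

(** The balls outside [A] are free, so every size from [#|R0|] to [#|R0| + #|T| - #|A|] is reached;
    the two bounds on [r] ensure this whatever [R0] is. *)
Lemma extend_coloring (T : finType) (A R0 : {set T}) r :
  R0 \subset A -> #|A| <= r -> #|A| + r <= #|T| ->
  exists2 R : {set T}, R :&: A = R0 & #|R| = r.
Proof.
move=> sRA lAr lArn.
have cR0 := subset_leq_card sRA.
have sU : R0 \subset R0 :|: ~: A by apply: subsetUl.
have bd : #|R0| <= r <= #|R0 :|: ~: A|.
  have := subset_leq_card (subsetUr R0 (~: A)).
  have := cardsC A; lia.
have [C [s1 s2 cC]] := intermediate_set sU bd.
exists C => //; apply/setP=> x; rewrite !inE.
apply/andP/idP => [[xC xA]|xR].
  by have := subsetP s2 _ xC; rewrite !inE xA orbF.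
by rewrite (subsetP s1) // (subsetP sRA).
Qed.

(** Half of [A :&: B], rounded down, is completed separately inside [A :\: B] and [B :\: A];
    evenness of [#|A|] and [#|B|] leaves enough room there. *)
Lemma balance_two_sets (T : finType) (A B : {set T}) :
  ~~ odd #|A| -> ~~ odd #|B| ->
  exists R : {set T}, 2 * #|A :&: R| = #|A| /\ 2 * #|B :&: R| = #|B|.
Proof.
move=> eA eB.
have cA := cardsID B A; have cB := cardsID A B; rewrite setIC in cB.
set i := #|A :&: B| in cA cB.
have [|RI sI cI] := @subset_of_card _ (A :&: B) i./2; first by rewrite /i; lia.
have [|RA sA cRA] := @subset_of_card _ (A :\: B) (#|A|./2 - i./2); first by lia.
have [|RB sB cRB] := @subset_of_card _ (B :\: A) (#|B|./2 - i./2); first by lia.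
have cU (C D E : {set T}) (C' D' : {set T}) : C \subset C' -> D \subset D' ->
    [disjoint C' & D'] -> E = C :|: D -> #|E| = #|C| + #|D|.
  move=> s1 s2 d ->; rewrite cardsU.
  suff -> : C :&: D = set0 by rewrite cards0 subn0.
  apply/eqP; rewrite -subset0; apply: subset_trans (setISS s1 s2) _.
  by rewrite subset0 setI_eq0.
have dAB (C D : {set T}) : [disjoint C :&: D & C :\: D].
  rewrite -setI_eq0; apply/eqP/setP=> x; rewrite !inE.
  by case: (x \in C); case: (x \in D).
have sub (C D : {set T}) x : C \subset D -> (x \in C) ==> (x \in D).
  by move/subsetP=> sCD; apply/implyP/sCD.
have mI x := sub _ _ x sI; have mA x := sub _ _ x sA; have mB x := sub _ _ x sB.
exists (RI :|: RA :|: RB); split.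
- rewrite (cU RI RA _ _ _ sI sA (dAB _ _)); first by rewrite cI cRA; lia.
  apply/setP=> x; move: (mI x) (mA x) (mB x); rewrite !inE.
  by case: (x \in A) (x \in B) (x \in RI) (x \in RA) (x \in RB)
    => [] [] [] [] [].
- move: (sI); rewrite setIC => sI'.
  rewrite (cU RI RB _ _ _ sI' sB (dAB _ _)); first by rewrite cI cRB; lia.
  apply/setP=> x; move: (mI x) (mA x) (mB x); rewrite !inE.
  by case: (x \in A) (x \in B) (x \in RI) (x \in RA) (x \in RB)
    => [] [] [] [] [].
Qed.

(** * From successful strategies to sets of red balls *)

Definition degree (T : finType) (Qs : seq {set T}) (x : T) :=
  count (fun Q : {set T} => x \in Q) Qs.

(* A coloring is encoded by its set of red balls; a query of size [k] meeting
   it in [a] balls has answer [minn a (k - a)]. *)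
Definition same_answers k (T : finType) (Qs : seq {set T}) (R R' : {set T}) :=
  forall Q, Q \in Qs ->
    #|Q :&: R'| = #|Q :&: R| \/ #|Q :&: R'| + #|Q :&: R| = k.

Definition even_forcing k (T : finType) (Qs : seq {set T}) :=
  forall R R' : {set T}, 2 * #|R| = #|T| -> same_answers k Qs R R' ->
  2 * #|R'| = #|T|.

Definition odd_forcing k (T : finType) (Qs : seq {set T}) :=
  forall m (R : {set T}), #|T| = m.*2.+1 -> #|R| = m.+1 ->
  exists2 i, i \in R &
    forall R' : {set T}, same_answers k Qs R R' -> #|R'| <= m -> i \notin R'.

Lemma card_color_split (T : finType) (E S : {set T}) :
  #|[set x in E | x \in S]| = #|E :&: S| /\
  #|[set x in E | x \notin S]| = #|E| - #|E :&: S|.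
Proof.
split; first by apply: eq_card => x; rewrite !inE.
by rewrite -(cardsID S E) addKn; apply: eq_card => x; rewrite !inE andbC.
Qed.

Lemma minn_same_answers k (T : finType) (Qs : seq {set T}) (R R' : {set T}) :
  (forall Q, Q \in Qs -> #|Q| = k) -> same_answers k Qs R R' ->
  forall Q, Q \in Qs ->
    minn #|[set x in Q | x \in R']| #|[set x in Q | x \notin R']| =
    minn #|[set x in Q | x \in R]| #|[set x in Q | x \notin R]|.
Proof.
move=> uQ sR Q QQs.
have [-> ->] := card_color_split Q R.
have [-> ->] := card_color_split Q R'.
rewrite (uQ _ QQs).
by case: (sR _ QQs); [move=> -> | lia].
Qed.

Lemma same_answers_consistent k n (Qs : seq {set 'I_n}) (R R' : {set 'I_n}) :
  (forall Q, Q \in Qs -> #|Q| = k) -> same_answers k Qs R R' ->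
  consistent Qs (fun x => x \in R) (fun x => x \in R').
Proof. by move=> uQ sR Q QQs; exact: (minn_same_answers uQ sR QQs). Qed.

Lemma card_color_class (T : finType) (R : {set T}) i :
  #|[set j | (j \in R) == (i \in R)]| = if i \in R then #|R| else #|T| - #|R|.
Proof.
case: ifP => iR; first by apply: eq_card => j; rewrite !inE eqb_id.
rewrite -(cardsC R) addKn.
by apply: eq_card => j; rewrite !inE eqbF_neg.
Qed.

Lemma majority_ballE n (R : {set 'I_n}) i :
  majority_ball (fun x => x \in R) i <->
  #|'I_n| < 2 * (if i \in R then #|R| else #|'I_n| - #|R|).
Proof. by rewrite /majority_ball card_color_class card_ord. Qed.

Lemma exists_majority (T : finType) (R : {set T}) :
  2 * #|R| != #|T| ->
  exists i, #|T| < 2 * (if i \in R then #|R| else #|T| - #|R|).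
Proof.
move=> ne; have cC := cardsC R.
case: (ltngtP (2 * #|R|) #|T|) ne => // [lt|gt] _.
  have /card_gt0P[j] : 0 < #|~: R| by lia.
  by rewrite inE => /negPf jR; exists j; rewrite jR; lia.
by have /card_gt0P[j jR] : 0 < #|R|; [lia | exists j; rewrite jR].
Qed.

(** In a tie no ball is a majority ball of [R] itself, which rules out the alternative naming a
    ball; in the other one every consistent coloring is a tie. *)
Lemma successful_even_forcing k n (Qs : seq {set 'I_n}) :
  (forall Q, Q \in Qs -> #|Q| = k) -> cm_successful Qs -> even_forcing k Qs.
Proof.
move=> uQ succ R R' cR sR.
have cons := same_answers_consistent uQ sR.
case: (succ (fun x => x \in R)) => [none|[i maj]].
  apply/eqP/negPn/negP => /exists_majority[i] /majority_ballE.
  exact: none.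
have /maj/majority_ballE : consistent Qs (fun x => x \in R) (fun x => x \in R).
  by [].
move: cR; move: #|R| #|'I_n| (i \in R) => a b [] <-; lia.
Qed.

(** An odd number of balls always has a majority ball, so the strategy must name one; it has the
    majority color, red for [R] and blue for [R']. *)
Lemma successful_odd_forcing k n (Qs : seq {set 'I_n}) :
  (forall Q, Q \in Qs -> #|Q| = k) -> cm_successful Qs -> odd_forcing k Qs.
Proof.
move=> uQ succ m R En cR.
have refl : consistent Qs (fun x => x \in R) (fun x => x \in R) by [].
case: (succ (fun x => x \in R)) => [none|[i maj]].
  have /exists_majority[i /majority_ballE] : 2 * #|R| != #|'I_n|.
    by rewrite cR En; lia.
  by move/none => /(_ refl).
exists i.
  by have /majority_ballE := maj _ refl; rewrite cR En; case: ifP; lia.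
move=> R' sR cR'; have /majority_ballE := maj _ (same_answers_consistent uQ sR).
by rewrite En; move: cR'; move: #|R'| => a la; case: ifP; lia.
Qed.

(** * Recoloring red balls without changing an answer *)

Definition removable k (T : finType) (Qs : seq {set T}) (R S : {set T}) :=
  [/\ S \subset R, S != set0 & same_answers k Qs R (R :\: S)].

Lemma card_removed k (T : finType) (Qs : seq {set T}) (R S : {set T}) :
  removable k Qs R S -> #|R :\: S| < #|R|.
Proof.
case=> sSR S0 _; rewrite cardsD (setIidPr sSR).
have := subset_leq_card sSR; have : 0 < #|S| by rewrite card_gt0.
lia.
Qed.

Lemma even_not_removable k (T : finType) (Qs : seq {set T}) (R S : {set T}) :
  even_forcing k Qs -> 2 * #|R| = #|T| -> ~ removable k Qs R S.
Proof.
move=> forc cR rS; have lt := card_removed rS; case: rS => _ _ sS.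
have := forc _ _ cR sS; lia.
Qed.

(** Turning [S] blue puts red in the minority, so the ball named for [R] must have left the red set.
    Removable sets without a common ball are thus contradictory. *)
Lemma odd_removable_common k m (T : finType) (Qs : seq {set T}) (R : {set T}) :
  odd_forcing k Qs -> #|T| = m.*2.+1 -> #|R| = m.+1 ->
  exists i, forall S, removable k Qs R S -> i \in S.
Proof.
move=> forc En cR; have [i iR hi] := forc _ _ En cR.
exists i => S rS; have lt := card_removed rS; case: rS => _ _ sS.
by have := hi _ sS; rewrite !inE iR andbT negbK; apply; rewrite -ltnS -cR.
Qed.

Lemma removable_isolated k (T : finType) (Qs : seq {set T}) (R : {set T}) z :
  degree Qs z = 0 -> z \in R -> removable k Qs R [set z].
Proof.
move=> dz zR; split; first by rewrite sub1set.
  by apply/set0Pn; exists z; rewrite inE.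
move=> Q QQs; left; apply: eq_card => x; rewrite !inE.
case: (x =P z) => //= ->.
have : ~~ has (fun Q : {set T} => z \in Q) Qs.
  by rewrite has_count -leqNgt leqn0; apply/eqP.
by move/hasPn/(_ _ QQs) => /negPf ->.
Qed.

Lemma size_le_degree (T : finType) (Qs s : seq {set T}) x :
  uniq s -> (forall Q, Q \in s -> Q \in Qs /\ x \in Q) -> size s <= degree Qs x.
Proof.
move=> us sQs; rewrite /degree -size_filter; apply: uniq_leq_size => // Q.
by rewrite mem_filter => /sQs[-> ->].
Qed.

Lemma degree1_unique (T : finType) (Qs : seq {set T}) x (Q Q' : {set T}) :
  degree Qs x = 1 -> Q \in Qs -> Q' \in Qs -> x \in Q -> x \in Q' -> Q' = Q.
Proof.
move=> d1 QQs Q'Qs xQ xQ'; apply/eqP/negPn/negP => ne.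
have : size [:: Q; Q'] <= degree Qs x; last by rewrite d1.
apply: size_le_degree => [|P]; first by rewrite /= inE eq_sym ne.
by rewrite !inE => /orP[] /eqP ->.
Qed.

(** The query [Q] passes from [k/2 + 1] to [k/2 - 1] red balls, two counts with sum [k], and no
    other query contains [x] or [y]. *)
Lemma removable_private_pair k (T : finType) (Qs : seq {set T})
    (R Q : {set T}) x y :
  Q \in Qs -> x != y -> x \in Q -> y \in Q ->
  degree Qs x = 1 -> degree Qs y = 1 -> x \in R -> y \in R ->
  2 * #|Q :&: R| = k.+2 -> removable k Qs R [set x; y].
Proof.
move=> QQs xy xQ yQ dx dy xR yR cQ; split.
- by apply/subsetP=> z; rewrite !inE => /orP[] /eqP ->.
- by apply/set0Pn; exists x; rewrite !inE eqxx.
move=> Q' Q'Qs; case: (eqVneq Q' Q) => [->|ne]; [right|left].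
  rewrite setIDA cardsD.
  have sQR : [set x; y] \subset Q :&: R.
    by apply/subsetP=> z; rewrite !inE => /orP[] /eqP ->; apply/andP.
  rewrite (setIidPr sQR).
  by have := subset_leq_card sQR; rewrite cards2 xy /=; lia.
have priv z : z \in Q -> degree Qs z = 1 -> z \notin Q'.
  move=> zQ dz; apply/negP => zQ'.
  by rewrite (degree1_unique dz QQs Q'Qs zQ zQ') eqxx in ne.
apply: eq_card => z; rewrite !inE.
by case: (z =P x) => [->|_]; [|case: (z =P y) => [->|_ //]];
   rewrite (negPf (priv _ _ _)).
Qed.

(** * Degree counting *)

Lemma sum_degree (T : finType) (Qs : seq {set T}) (A : {set T}) :
  \sum_(x in A) degree Qs x = \sum_(Q <- Qs) #|Q :&: A|.
Proof.
elim: Qs => [|Q Qs IH]; first by rewrite big_nil big1.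
rewrite big_cons -IH /degree /= big_split /=; congr (_ + _).
rewrite -sum1_card [RHS](eq_bigl (fun x => (x \in A) && (x \in Q))).
  by rewrite [RHS]big_mkcondr; apply: eq_bigr => x _; case: (x \in Q).
by move=> x; rewrite !inE andbC.
Qed.

Lemma sum_degree_uniform k (T : finType) (Qs : seq {set T}) :
  (forall Q, Q \in Qs -> #|Q| = k) -> \sum_x degree Qs x = k * size Qs.
Proof.
move=> uQ; transitivity (\sum_(x in [set: T]) degree Qs x).
  by apply: eq_bigl => x; rewrite inE.
rewrite sum_degree big_seq_cond (eq_bigr (fun=> k)).
  by rewrite -big_seq_cond big_const_seq iter_addn_0 count_predT.
by move=> Q /andP[QQs _]; rewrite setIT uQ.
Qed.

Definition degree_class (T : finType) (Qs : seq {set T}) d :=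
  [set x | degree Qs x == d].

(** Each ball is compared with degree 2: the right side makes up for degrees 0 and 1, and a degree
    above 2 leaves a surplus of at least one. *)
Lemma degree_deficiency k (T : finType) (Qs : seq {set T}) :
  (forall Q, Q \in Qs -> #|Q| = k) ->
  2 * #|T| + #|[set x | 2 < degree Qs x]| <=
  k * size Qs + #|degree_class Qs 1| + 2 * #|degree_class Qs 0|.
Proof.
move=> uQ; rewrite -(sum_degree_uniform uQ).
have cE (P : pred T) : #|[set x | P x]| = \sum_x P x.
  rewrite -sum1_card big_mkcond; apply: eq_bigr => x _.
  by rewrite inE; case: (P x).
have -> : 2 * #|T| = \sum_(x : T) 2 by rewrite sum_nat_const mulnC.
rewrite !cE big_distrr /= -!big_split /=; apply: leq_sum => x _; lia.
Qed.

Lemma card_degree1 (T : finType) (Qs : seq {set T}) :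
  #|degree_class Qs 1| = \sum_(Q <- Qs) #|Q :&: degree_class Qs 1|.
Proof.
by rewrite -sum_degree -sum1_card; apply: eq_bigr => x; rewrite inE => /eqP.
Qed.

Lemma sum_seq_le (T : eqType) (s : seq T) (F G : T -> nat) :
  (forall x, x \in s -> F x <= G x) -> \sum_(x <- s) F x <= \sum_(x <- s) G x.
Proof.
move=> le; rewrite big_seq_cond [leqRHS]big_seq_cond.
by apply: leq_sum => x /andP[/le].
Qed.

(** * Even query size, even number of balls *)

(** [P] holds the balls to be recolored and [Z] the balls outside [Q] that must be red. One red ball
    above half of [Q] is what [removable_private_pair] requires. *)
Lemma color_query (T : finType) (Q P Z : {set T}) r :
  ~~ odd #|Q| -> P \subset Q -> 2 * #|P| <= #|Q|.+2 -> 2 <= #|Q| ->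
  [disjoint Z & Q] -> #|Q| + #|Z| <= r -> #|Q| + #|Z| + r <= #|T| ->
  exists R : {set T},
    [/\ P \subset R, Z \subset R, 2 * #|Q :&: R| = #|Q|.+2 & #|R| = r].
Proof.
move=> eQ sPQ cP Q2 dZQ lr lT.
have [|S [sPS sSQ cS]] := @intermediate_set _ P Q #|Q|./2.+1 sPQ; first by lia.
have cA : #|Q :|: Z| <= #|Q| + #|Z| by rewrite cardsU leq_subr.
have [|||R ER cR] := @extend_coloring _ (Q :|: Z) (S :|: Z) r.
- exact: setSU.
- exact: leq_trans lr.
- by apply: leq_trans lT; rewrite leq_add2r.
have sR : S :|: Z \subset R by rewrite -ER subsetIl.
exists R; split=> //.
- by apply: subset_trans sPS (subset_trans (subsetUl _ _) sR).
- by apply: subset_trans (subsetUr _ _) sR.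
suff -> : Q :&: R = S by rewrite cS; lia.
apply/setP=> x; have /setP/(_ x) := ER; rewrite !inE => e.
case xQ: (x \in Q); rewrite ?xQ ?andbT /= in e *.
  by rewrite e (disjointFl dZQ xQ) orbF.
by apply/esym; apply: contraFF xQ; apply: (subsetP sSQ).
Qed.

Lemma two_degree1P (T : finType) (Qs : seq {set T}) (Q : {set T}) :
  1 < #|Q :&: degree_class Qs 1| ->
  exists x y, [/\ x != y, x \in Q, y \in Q, degree Qs x = 1 & degree Qs y = 1].
Proof.
case/card_gt1P=> x [y []]; rewrite !inE => /andP[xQ /eqP dx] /andP[yQ /eqP dy].
by move=> ne; exists x, y.
Qed.

Lemma even_private_le1 k (T : finType) (Qs : seq {set T}) (Q : {set T}) :
  (forall Q, Q \in Qs -> #|Q| = k) -> ~~ odd k -> ~~ odd #|T| ->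
  2 * k <= #|T| -> even_forcing k Qs -> Q \in Qs ->
  #|Q :&: degree_class Qs 1| <= 1.
Proof.
move=> uQ ek eT lT forc QQs; rewrite leqNgt; apply/negP=> /two_degree1P.
case=> x [y [xy xQ yQ dx dy]]; have cQ := uQ _ QQs.
have sP : [set x; y] \subset Q.
  by apply/subsetP=> u; rewrite !inE => /orP[] /eqP ->.
have := subset_leq_card sP; rewrite cards2 xy cQ => k2.
have [|||||||R [sPR _ cQR cR]] := @color_query _ Q [set x; y] set0 #|T|./2.
all: rewrite ?cQ ?cards0 ?cards2 ?xy //; try by move: k2 ek lT eT; clear; lia.
  by rewrite -setI_eq0 set0I.
apply: (@even_not_removable _ _ _ R [set x; y] forc); first by lia.
apply: (removable_private_pair QQs) => //; last by rewrite cQR cQ.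
  by rewrite (subsetP sPR) // !inE eqxx.
by rewrite (subsetP sPR) // !inE eqxx orbT.
Qed.

Lemma even_even_bound k (T : finType) (Qs : seq {set T}) :
  (forall Q, Q \in Qs -> #|Q| = k) -> ~~ odd k -> ~~ odd #|T| ->
  2 * k <= #|T| -> 2 <= #|T| -> even_forcing k Qs ->
  2 * #|T| <= (k + 1) * size Qs.
Proof.
move=> uQ ek eT lT T2 forc.
have D0 : #|degree_class Qs 0| = 0.
  apply/eqP; rewrite cards_eq0 -subset0; apply/subsetP=> z; rewrite inE.
  move/eqP=> dz; exfalso.
  have [|R [sR _ cR]] :=
    @intermediate_set _ [set z] setT #|T|./2 (subsetT _).
    by rewrite cards1 cardsT; lia.
  apply: (@even_not_removable _ _ _ R [set z] forc); first by lia.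
  by apply: removable_isolated; rewrite // (subsetP sR) ?inE.
have := degree_deficiency uQ.
have : #|degree_class Qs 1| <= size Qs.
  rewrite card_degree1 -sum1_size.
  by apply: sum_seq_le => Q; apply: (even_private_le1 uQ).
lia.
Qed.

(** * Even query size, odd number of balls *)

Lemma odd_isolated_le1 k m (T : finType) (Qs : seq {set T}) :
  odd_forcing k Qs -> #|T| = m.*2.+1 -> 2 <= m -> #|degree_class Qs 0| <= 1.
Proof.
move=> forc ET m2; rewrite leqNgt; apply/negP=> /card_gt1P[x [y []]].
rewrite !inE => /eqP dx /eqP dy xy.
have [|R [sR _ cR]] :=
  @intermediate_set _ [set x; y] setT m.+1 (subsetT _).
  by rewrite cards2 xy cardsT; lia.
have [xR yR] : x \in R /\ y \in R.
  by split; rewrite (subsetP sR) // !inE eqxx ?orbT.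
have [i hi] := odd_removable_common forc ET cR.
have := hi _ (removable_isolated _ dx xR).
have := hi _ (removable_isolated _ dy yR).
by rewrite !inE => /eqP -> /eqP e; rewrite e eqxx in xy.
Qed.

(** Given three balls of degree 1 in a query, one coloring makes all three pairs removable, and no
    ball lies in all of them. *)
Lemma odd_private_le2 k m (T : finType) (Qs : seq {set T}) (Q : {set T}) :
  (forall Q, Q \in Qs -> #|Q| = k) -> ~~ odd k -> odd_forcing k Qs ->
  #|T| = m.*2.+1 -> k <= m -> Q \in Qs -> #|Q :&: degree_class Qs 1| <= 2.
Proof.
move=> uQ ek forc ET lm QQs; rewrite leqNgt; apply/negP=> /card_gt2P.
case=> x [y [z [[]]]]; rewrite !inE.
move=> /andP[xQ /eqP dx] /andP[yQ /eqP dy] /andP[zQ /eqP dz] [xy yz zx].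
have cQ := uQ _ QQs.
have sP : [set x; y; z] \subset Q.
  by apply/subsetP=> u; rewrite !inE -orbA => /or3P[] /eqP ->.
have cP : #|[set x; y; z]| = 3.
  rewrite setUC cardsU1 cards2 xy !inE negb_or zx [z == y]eq_sym yz //.
have := subset_leq_card sP; rewrite cP cQ => k3.
have [|||||||R [sPR _ cQR cR]] := @color_query _ Q [set x; y; z] set0 m.+1.
all: rewrite ?cQ ?cards0 ?cP //; try by move: k3 ek lm ET; clear; lia.
  by rewrite -setI_eq0 set0I.
have [i hi] := odd_removable_common forc ET cR.
have [xR yR zR] : [/\ x \in R, y \in R & z \in R].
  by split; rewrite (subsetP sPR) // !inE eqxx ?orbT.
rewrite cQ in cQR.
have := hi _ (removable_private_pair QQs xy xQ yQ dx dy xR yR cQR).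
have := hi _ (removable_private_pair QQs yz yQ zQ dy dz yR zR cQR).
have := hi _ (removable_private_pair QQs zx zQ xQ dz dx zR xR cQR).
rewrite !inE => /orP[] /eqP ->.
  by rewrite (negPf zx) [z == y]eq_sym (negPf yz).
by rewrite (negPf xy) [x == z]eq_sym (negPf zx).
Qed.

Lemma odd_isolated_private_le1 k m (T : finType) (Qs : seq {set T})
    (Q : {set T}) z :
  (forall Q, Q \in Qs -> #|Q| = k) -> ~~ odd k -> odd_forcing k Qs ->
  #|T| = m.*2.+1 -> k < m -> Q \in Qs -> degree Qs z = 0 ->
  #|Q :&: degree_class Qs 1| <= 1.
Proof.
move=> uQ ek forc ET lm QQs dz; rewrite leqNgt; apply/negP=> /two_degree1P.
case=> x [y [xy xQ yQ dx dy]]; have cQ := uQ _ QQs.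
have sP : [set x; y] \subset Q.
  by apply/subsetP=> u; rewrite !inE => /orP[] /eqP ->.
have := subset_leq_card sP; rewrite cards2 xy cQ => k2.
have zQ : z \notin Q.
  apply/negP=> zQ; suff : 0 < degree Qs z by rewrite dz.
  by rewrite /degree -has_count; apply/hasP; exists Q.
have [|||||||R [sPR sZ cQR cR]] := @color_query _ Q [set x; y] [set z] m.+1.
all: rewrite ?cQ ?cards1 ?cards2 ?xy //; try by move: k2 ek lm ET; clear; lia.
  by rewrite disjoints1.
have [i hi] := odd_removable_common forc ET cR.
have zR : z \in R by rewrite (subsetP sZ) ?inE.
have [xR yR] : x \in R /\ y \in R.
  by split; rewrite (subsetP sPR) // !inE eqxx ?orbT.
rewrite cQ in cQR.
have := hi _ (removable_isolated _ dz zR).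
have := hi _ (removable_private_pair QQs xy xQ yQ dx dy xR yR cQR).
by rewrite !inE => /orP[] /eqP -> /eqP e; rewrite -e ?dx ?dy in dz.
Qed.

(** With [#|P| = 2] this gives [Q] one red ball more than half; [P'] stands for the pair belonging
    to another query. *)
Lemma card_balanced_plus (T : finType) (Q B P P' : {set T}) :
  P \subset Q -> [disjoint P' & Q] -> 2 * #|(Q :\: P) :&: B| = #|Q :\: P| ->
  2 * #|Q :&: (B :|: P :|: P')| = #|Q| + #|P|.
Proof.
move=> sPQ dis cB.
have -> : Q :&: (B :|: P :|: P') = ((Q :\: P) :&: B) :|: P.
  apply/setP=> u; rewrite !inE; case uQ: (u \in Q) => /=.
    by rewrite (disjointFl dis uQ) orbF andbT; case: (u \in P); rewrite ?orbT.
  by rewrite andbF; apply/esym; apply: contraFF uQ; apply: (subsetP sPQ).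
rewrite cardsU.
have -> : (Q :\: P) :&: B :&: P = set0.
  by apply/setP=> u; rewrite !inE; case: (u \in P); rewrite ?andbF.
have := cardsID P Q; rewrite (setIidPr sPQ) cards0; move: cB; clear; lia.
Qed.

(** Two such queries would carry disjoint pairs, both removable for one coloring: both pairs are
    red, and the rests of [Q] and [Q'] are balanced simultaneously. *)
Lemma odd_private_pair_unique k m (T : finType) (Qs : seq {set T})
    (Q Q' : {set T}) :
  (forall Q, Q \in Qs -> #|Q| = k) -> ~~ odd k -> odd_forcing k Qs ->
  #|T| = m.*2.+1 -> 2 * k <= m -> Q \in Qs -> Q' \in Qs ->
  1 < #|Q :&: degree_class Qs 1| -> 1 < #|Q' :&: degree_class Qs 1| -> Q' = Q.
Proof.
move=> uQ ek forc ET lm QQs Q'Qs /two_degree1P[x [y [xy xQ yQ dx dy]]].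
case/two_degree1P=> [x' [y' [xy' xQ' yQ' dx' dy']]].
apply/eqP/negPn/negP => ne.
have sub2 (C : {set T}) u v : u \in C -> v \in C -> [set u; v] \subset C.
  by move=> uC vC; apply/subsetP=> w; rewrite !inE => /orP[] /eqP ->.
have disj (C C' : {set T}) u v : C \in Qs -> C' \in Qs -> C' != C ->
    u \in C -> v \in C -> degree Qs u = 1 -> degree Qs v = 1 ->
    [disjoint [set u; v] & C'].
  move=> CQs C'Qs neC uC vC du dv; rewrite disjoint_subset; apply/subsetP=> w.
  rewrite !inE => /orP[] /eqP ->; apply/negP => wC'.
    by rewrite (degree1_unique du CQs C'Qs uC wC') eqxx in neC.
  by rewrite (degree1_unique dv CQs C'Qs vC wC') eqxx in neC.
have sP := sub2 _ _ _ xQ yQ; have sP' := sub2 _ _ _ xQ' yQ'.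
have dP : [disjoint [set x; y] & Q'] by apply: (disj Q).
have dP' : [disjoint [set x'; y'] & Q] by apply: (disj Q') => //; rewrite eq_sym.
have cP : #|[set x; y]| = 2 by rewrite cards2 xy.
have cP' : #|[set x'; y']| = 2 by rewrite cards2 xy'.
have cQ := uQ _ QQs; have cQ' := uQ _ Q'Qs.
have cT : #|Q :\: [set x; y]| = k - 2 by rewrite cardsD (setIidPr sP) cP cQ.
have cT' : #|Q' :\: [set x'; y']| = k - 2.
  by rewrite cardsD (setIidPr sP') cP' cQ'.
have k2 : 2 <= k by have := subset_leq_card sP; rewrite cP cQ.
have ek2 : ~~ odd (k - 2) by rewrite oddB // addbF.
have [||B [B1 B2]] := @balance_two_sets _ (Q :\: [set x; y])
  (Q' :\: [set x'; y']); rewrite ?cT ?cT' //.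
pose R0 := (Q :|: Q') :&: (B :|: [set x; y] :|: [set x'; y']).
have cA : #|Q :|: Q'| <= k + k by rewrite cardsU cQ cQ' leq_subr.
have [|||R ER cR] := @extend_coloring _ (Q :|: Q') R0 m.+1.
- exact: subsetIl.
- by apply: leq_trans cA _; move: lm; clear; lia.
- by apply: leq_trans (_ : k + k + m.+1 <= _); [rewrite leq_add2r | move: lm ET; clear; lia].
have eQ (C : {set T}) : C \subset Q :|: Q' ->
    C :&: R = C :&: (B :|: [set x; y] :|: [set x'; y']).
  move=> sC; rewrite -[in LHS](setIidPl sC) -setIA [_ :&: R]setIC ER /R0.
  by rewrite setIA (setIidPl sC).
have c1 : 2 * #|Q :&: R| = k.+2.
  by rewrite eQ ?subsetUl // (card_balanced_plus sP dP') ?cP ?cQ ?addn2 // cT.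
have c2 : 2 * #|Q' :&: R| = k.+2.
  rewrite eQ ?subsetUr // -setUA [_ :|: [set x'; y']]setUC setUA.
  by rewrite (card_balanced_plus sP' dP) ?cP' ?cQ' ?addn2 // cT'.
have sR : R0 \subset R by rewrite -ER subsetIl.
have inR u : u \in Q :|: Q' -> u \in [set x; y] :|: [set x'; y'] -> u \in R.
  by move=> uA uP; rewrite (subsetP sR) // inE uA -setUA inE uP orbT.
have [i hi] := odd_removable_common forc ET cR.
have i1 : i \in [set x; y].
  by apply/hi/(removable_private_pair QQs) => //;
     apply: inR; rewrite !inE ?xQ ?yQ ?eqxx ?orbT.
have : i \in [set x'; y'].
  by apply/hi/(removable_private_pair Q'Qs) => //;
     apply: inR; rewrite !inE ?xQ' ?yQ' ?eqxx ?orbT.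
by move/(subsetP sP'); rewrite (disjointFr dP i1).
Qed.

(** The isolated ball [z] must be the named one. Making [e] red and [a], [b] blue keeps every red
    count: [A] trades [a] for [e], [B] trades [b] for [e], and the other queries contain none of the
    three. Only [m] red balls remain, yet [z] is among them. *)
Lemma odd_no_swap k m (T : finType) (Qs : seq {set T}) (A B : {set T}) a b e z :
  odd_forcing k Qs -> #|T| = m.*2.+1 -> 2 <= m ->
  A \in Qs -> B \in Qs -> A != B -> degree Qs z = 0 ->
  a \in A -> degree Qs a = 1 -> b \in B -> degree Qs b = 1 ->
  e \in A -> e \in B -> degree Qs e = 2 -> False.
Proof.
move=> forc ET m2 AQs BQs AB dz aA da bB db eA eB de.
have neq u v : degree Qs u != degree Qs v -> u != v.
  by apply: contraNneq => ->.
have bA : b \notin A.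
  apply/negP=> bA; have := degree1_unique db BQs AQs bB bA.
  by move/eqP; rewrite (negPf AB).
have aB : a \notin B.
  apply/negP=> aB; have := degree1_unique da AQs BQs aA aB.
  by move/eqP; rewrite eq_sym (negPf AB).
have ab : a != b by apply: contraNneq bA => <-.
have [za zb ea eb ez] : [/\ z != a, z != b, e != a, e != b & e != z].
  by split; apply: neq; rewrite ?dz ?da ?db ?de.
have sP : [set a; b; z] \subset [set~ e].
  apply/subsetP=> u; rewrite !inE -orbA.
  by case/or3P=> /eqP ->; rewrite eq_sym.
have [|R [sPR sRe cR]] := @intermediate_set _ _ _ m.+1 sP.
  have : #|[set a; b; z]| <= 3.
    by rewrite setUC cardsU1 cards2; do 2 case: (~~ _).
  by have := cardsC1 e; rewrite ET; move: m2; clear; lia.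
have [aR bR zR] : [/\ a \in R, b \in R & z \in R].
  by split; rewrite (subsetP sPR) // !inE eqxx ?orbT.
have eR : e \notin R by apply/negP=> /(subsetP sRe); rewrite !inE eqxx.
have [i iR hi] := forc _ _ ET cR.
pose R' := e |: (R :\: [set a; b]).
have zR' : z \in R' by rewrite !inE zR (negPf za) (negPf zb) orbT.
have iz : i = z.
  have rz := removable_isolated k dz zR.
  have := card_removed rz; case: rz => _ _ sz; rewrite cR ltnS => lz.
  by have := hi _ sz lz; rewrite !inE iR andbT negbK => /eqP.
have : i \notin R'; last by rewrite iz zR'.
apply: hi.
  move=> Q QQs; left.
  have swap x : x \in Q -> x \in R -> e \in Q ->
      Q :&: R' = e |: ((Q :&: R) :\ x) -> #|Q :&: R'| = #|Q :&: R|.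
    move=> xQ xR eQ ->; rewrite cardsU1 [RHS](cardsD1 x) !inE xQ xR.
    by rewrite (negPf eR) !andbF.
  have [EA|nA] := eqVneq Q A.
    apply: (swap a); rewrite ?EA //; apply/setP=> u; rewrite !inE.
    case: (u =P e) => [->|_] /=; first by rewrite eA.
    by case: (u =P b) => [->|_]; rewrite ?(negPf bA) ?andbF //= orbF andbCA.
  have [EB|nB] := eqVneq Q B.
    apply: (swap b); rewrite ?EB //; apply/setP=> u; rewrite !inE.
    case: (u =P e) => [->|_] /=; first by rewrite eB.
    by case: (u =P a) => [->|_]; rewrite ?(negPf aB) ?andbF //= andbCA.
  have aQ : a \notin Q.
    by apply/negP=> aQ; rewrite (degree1_unique da AQs QQs aA aQ) eqxx in nA.
  have bQ : b \notin Q.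
    by apply/negP=> bQ; rewrite (degree1_unique db BQs QQs bB bQ) eqxx in nB.
  have eQ : e \notin Q.
    apply/negP=> eQ; have : size [:: Q; A; B] <= degree Qs e; last by rewrite de.
    apply: size_le_degree => [|C]; first by rewrite /= !inE negb_or nA nB AB.
    by rewrite !inE => /or3P[] /eqP ->.
  apply: eq_card => u; rewrite !inE.
  case: (u =P e) => [->|_]; first by rewrite (negPf eQ).
  case: (u =P a) => [->|_]; first by rewrite (negPf aQ).
  by case: (u =P b) => [->|_]; first by rewrite (negPf bQ).
have sab : [set a; b] \subset R.
  by apply/subsetP=> u; rewrite !inE => /orP[] /eqP ->.
rewrite cardsU1 cardsD (setIidPr sab) cards2 ab cR !inE.
by move: m2; clear; case: (~~ _); lia.
Qed.

(** Without isolated balls, at most one query, listed once, has two balls of degree 1, which costs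
    one unit. With one isolated ball, the missing unit comes from a ball of degree above 2 or from a
    query without balls of degree 1; failing both, [odd_no_swap] applies. *)
Lemma even_odd_bound k m (T : finType) (Qs : seq {set T}) :
  (forall Q, Q \in Qs -> #|Q| = k) -> 2 <= k -> ~~ odd k -> odd_forcing k Qs ->
  #|T| = m.*2.+1 -> 2 * k <= m -> (2 * #|T|).-1 <= (k + 1) * size Qs.
Proof.
move=> uQ k2 ek forc ET lm; have def := degree_deficiency uQ.
have m2 : 2 <= m by move: k2 lm; clear; lia.
have D0le := odd_isolated_le1 forc ET m2.
set D1 := degree_class Qs 1 in def *; set D0 := degree_class Qs 0 in def D0le *.
have [D00|[z]] := set_0Vmem D0.
  have : #|D1| <= (size Qs).+1.
    case: (boolP (has (fun Q : {set T} => 1 < #|Q :&: D1|) Qs)); last first.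
      move/hasPn=> le1; apply: leqW; rewrite card_degree1 -sum1_size.
      by apply: sum_seq_le => Q /le1; rewrite -leqNgt.
    case/hasP=> Q0 Q0Qs gt1.
    have [x [_ [_ xQ _ dx _]]] := two_degree1P gt1.
    (* [Qs] may repeat a query, but not [Q0], which contains a ball of degree 1. *)
    have c1 : count_mem Q0 Qs <= 1.
      by rewrite -dx; apply: sub_count => Q /= /eqP ->.
    apply: leq_trans (_ : size Qs + count_mem Q0 Qs <= _); last first.
      by rewrite -addn1 leq_add2l.
    rewrite card_degree1 -sum1_size -sum1_count [X in _ + X]big_mkcond.
    rewrite -big_split; apply: sum_seq_le => Q QQs /=.
    case: eqP => [->|/eqP ne].
      by apply: (odd_private_le2 uQ ek forc ET _ Q0Qs); move: lm; clear; lia.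
    rewrite addn0 leqNgt; apply: contraNN ne => gtQ.
    by apply/eqP; apply: (odd_private_pair_unique uQ ek forc ET lm).
  by move: def; rewrite D00 cards0; clear; lia.
rewrite inE => /eqP dz.
have le1 Q : Q \in Qs -> #|Q :&: D1| <= 1.
  by move=> QQs; apply: (odd_isolated_private_le1 uQ ek forc ET _ QQs dz); move: lm m2; clear; lia.
have D1le : #|D1| <= size Qs.
  by rewrite card_degree1 -sum1_size; apply: sum_seq_le.
have [D30|[x xD3]] := set_0Vmem [set x | 2 < degree Qs x]; last first.
  have : 0 < #|[set x | 2 < degree Qs x]| by apply/card_gt0P; exists x.
  by move: def D0le D1le; clear; lia.
case: (boolP (has (fun Q : {set T} => #|Q :&: D1| == 0) Qs)).
  case/hasP=> Q0 Q0Qs /eqP Q00.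
  have : #|D1| < size Qs; last by move: def D0le; clear; lia.
  rewrite card_degree1 -sum1_size !(big_rem Q0 Q0Qs) /= Q00 add0n add1n ltnS.
  by apply: sum_seq_le => Q /mem_rem; apply: le1.
move/hasPn=> ge1; exfalso.
have priv Q : Q \in Qs -> exists2 a, a \in Q & degree Qs a = 1.
  move=> /ge1; rewrite -lt0n => /card_gt0P[a]; rewrite !inE.
  by case/andP=> aQ /eqP; exists a.
have [A AQs] : exists A, A \in Qs.
  have : 0 < size Qs; last by case: (Qs) => // A Qs'; exists A; rewrite inE eqxx.
  rewrite lt0n; apply/eqP=> s0; move: def D0le D1le.
  by rewrite s0 muln0 ET; move: m2; clear; lia.
have [a aA da] := priv _ AQs.
have [e eA ne] : exists2 e, e \in A & e \notin D1.
  have : 0 < #|A :\: D1|.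
    by have := cardsID D1 A; have := le1 _ AQs; rewrite (uQ _ AQs); move: k2; clear; lia.
  by case/card_gt0P=> e; rewrite inE => /andP[]; exists e.
have de : degree Qs e = 2.
  have : 0 < degree Qs e.
    by rewrite /degree -has_count; apply/hasP; exists A.
  have : e \notin [set x | 2 < degree Qs x] by rewrite D30 inE.
  by move: ne; rewrite !inE; clear; lia.
(* Otherwise all queries through [e] are copies of [A], hence contain [a], and
   [degree Qs e <= degree Qs a]. *)
have [B BQs /andP[eB AB]] :
    exists2 B, B \in Qs & (e \in B) && (A != B).
  have : has (fun B : {set T} => (e \in B) && (A != B)) Qs; last by move/hasP.
  apply: contraTT isT => /hasPn hno.
  have : degree Qs e <= degree Qs a; last by rewrite de da.
  rewrite /degree -!size_filter -(eq_in_filter (a1 := pred1 A)).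
    by rewrite !size_filter; apply: sub_count => Q /= /eqP ->.
  move=> Q /hno; rewrite /= negb_and negbK eq_sym.
  by case: (Q =P A) => [-> _|_]; rewrite ?eA ?orbF //= => /negPf ->.
have [b bB db] := priv _ BQs.
exact: (odd_no_swap forc ET m2 AQs BQs AB dz aA da bB db eA eB de).
Qed.

(** * Property C and [dC] *)

Lemma dC_propertyC k n (H : {set {set 'I_n}}) :
  uniform k H -> #|H| < dC k n -> propertyCb H.
Proof.
(* If [dC] takes its default value 0, the hypothesis on [#|H|] is impossible. *)
move=> uH; rewrite /dC; case: pickP => [H0 nH0|_]; last by rewrite ltn0.
case: arg_minnP => // H1 _ minH; apply: contraTT => nC; rewrite -leqNgt.
by apply: minH; rewrite /noC uH.
Qed.

Lemma monochromatic_subset (T : finType) (V S : {set T}) k :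
  #|V| = 2 * k ->
  exists E : {set T},
    [/\ E \subset V, #|E| = k & #|E :&: S| = k \/ #|E :&: S| = 0].
Proof.
move=> cV; have cID := cardsID S V; rewrite cV in cID.
case: (leqP k #|V :&: S|) => [/subset_of_card[E sE cE]|lt].
  have [sEV sES] := (subset_trans sE (subsetIl _ _),
                     subset_trans sE (subsetIr _ _)).
  by exists E; split=> //; left; rewrite (setIidPl sES).
have [|E sE cE] := @subset_of_card _ (V :\: S) k; first by lia.
exists E; split=> //; first exact: subset_trans sE (subsetDl _ _).
right; apply/eqP; rewrite cards_eq0 setI_eq0.
by apply: disjointWl sE _; rewrite -setI_eq0 setIDAC setDIl setDv setI0.
Qed.

Lemma balancedE n (c : 'I_n -> bool) (E : {set 'I_n}) :
  let a := #|E :&: [set x | c x]| in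
  balanced c E = (a <= (#|E| - a).+1) && (#|E| - a <= a.+1).
Proof.
have [e1 e2] := card_color_split E [set x | c x].
rewrite /= -e2 -e1 /balanced; congr ((_ <= _.+1) && (_ <= _.+1)).
all: by apply: eq_card => x; rewrite !inE.
Qed.

(** The [k]-subsets of a fixed set of [2 * k] balls violate Property C: one of them is
    monochromatic, hence unbalanced as [k >= 2]. *)
Lemma dC_le k n : 2 <= k -> 2 * k <= n -> dC k n <= 2 ^ (2 * k).
Proof.
move=> k2 kn.
have [|V _ cV] := @subset_of_card 'I_n setT (2 * k).
  by rewrite cardsT card_ord.
pose H := [set E : {set 'I_n} in powerset V | #|E| == k].
have uH : uniform k H by apply/forall_inP => E; rewrite inE => /andP[].
have cH : #|H| <= 2 ^ (2 * k).
  rewrite -cV -card_powerset; apply: subset_leq_card.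
  by apply/subsetP=> E; rewrite inE => /andP[].
apply: leq_trans cH; rewrite leqNgt; apply/negP => /(dC_propertyC uH).
case/existsP=> c /forall_inP bal.
have [E [sEV cE mono]] := monochromatic_subset [set x | c x] cV.
have /bal : E \in H by rewrite !inE sEV cE /=.
by rewrite balancedE cE; case: mono => ->; rewrite ?subnn ?subn0; lia.
Qed.

(* The link of a ball lives on the other [n - 1] balls; here these are kept
   inside the full ball set. *)
Definition balanceable k d (T : finType) :=
  forall (x : T) (H : {set {set T}}),
    (forall E, E \in H -> #|E| = k /\ x \notin E) -> #|H| < d ->
  exists R : {set T}, forall E, E \in H -> 2 * #|E :&: R| = k.

Lemma card_preim_lift n (x : 'I_n.+1) (E : {set 'I_n.+1}) :
  x \notin E -> #|lift x @^-1: E| = #|E|.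
Proof.
move=> xE; rewrite -(card_imset _ (@lift_inj _ x)); apply: eq_card => y.
apply/imsetP/idP => [[j]|yE]; first by rewrite inE => jE ->.
have := unliftP x y; case=> [j Ej|Ey]; last by rewrite Ey (negPf xE) in yE.
by exists j => //; rewrite inE -Ej.
Qed.

(** The balls other than [x] are identified with ['I_n] through [lift x]; on an edge of even size,
    balanced means an exact half. *)
Lemma dC_balanceable k n : ~~ odd k -> balanceable k (dC k n) 'I_n.+1.
Proof.
move=> ek x H hH cH.
pose H' := [set lift x @^-1: E | E : {set 'I_n.+1} in H].
have uH' : uniform k H'.
  apply/forall_inP => _ /imsetP[E EH ->].
  by have [cE xE] := hH _ EH; rewrite card_preim_lift ?cE.
have cH' : #|H'| < dC k n by apply: leq_ltn_trans cH; apply: leq_imset_card.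
have /existsP[c /forall_inP bal] := dC_propertyC uH' cH'.
exists (lift x @: [set j | c j]) => E EH; have [cE xE] := hH _ EH.
have /bal : lift x @^-1: E \in H' by apply: imset_f.
rewrite balancedE card_preim_lift // cE.
have -> : lift x @^-1: E :&: [set j | c j] =
    lift x @^-1: (E :&: lift x @: [set j | c j]).
  by apply/setP=> j; rewrite !inE (mem_imset _ _ (@lift_inj _ x)) inE.
rewrite card_preim_lift; last by rewrite inE (negPf xE).
have := subset_leq_card (subsetIl E (lift x @: [set j | c j])); rewrite cE.
move: ek; move: #|_ :&: _| => a; clear; lia.
Qed.

(** * Odd query size *)

Lemma removable_single k (T : finType) (Qs : seq {set T}) (R : {set T}) x :
  x \in R -> (forall Q, Q \in Qs -> x \in Q -> 2 * #|Q :&: R| = k.+1) ->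
  removable k Qs R [set x].
Proof.
move=> xR hQ; split; first by rewrite sub1set.
  by apply/set0Pn; exists x; rewrite inE.
move=> Q QQs; case xQ: (x \in Q); [right|left].
  have := hQ _ QQs xQ; rewrite setIDA (cardsD1 x (Q :&: R)) inE xQ xR.
  by clear; lia.
by apply: eq_card => u; rewrite !inE; case: (u =P x) => // ->; rewrite xQ.
Qed.

(* Merging [x] and [y] into one vertex turns the two links into a single
   hypergraph, whose balanced coloring extends by giving [x] and [y] the same
   color. *)
Lemma link_coloring k d (T : finType) (Qs : seq {set T}) x y r :
  (forall Q, Q \in Qs -> #|Q| = k) -> odd k -> balanceable k.-1 d T ->
  count (fun Q : {set T} => (x \in Q) || (y \in Q)) Qs < d ->
  d * k + 2 <= r -> d * k + 2 + r <= #|T| ->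
  exists R : {set T}, [/\ x \in R, y \in R, #|R| = r &
    forall Q, Q \in Qs -> (x \in Q) || (y \in Q) -> 2 * #|Q :&: R| = k.+1].
Proof.
move=> uQ ok bal cnt lr lT.
(* [w Q] plays the merged vertex and is deleted from [Q]; a query containing both balls loses [x]
   and keeps [y], so no edge of [H] contains [x]. *)
pose w (Q : {set T}) := if x \in Q then x else y.
pose hits (Q : {set T}) := (x \in Q) || (y \in Q).
pose trim (Q : {set T}) := Q :\ w Q.
pose H := [set E in map trim (filter hits Qs)].
have wQ (Q : {set T}) : (x \in Q) || (y \in Q) -> w Q \in Q.
  by rewrite /w; case: ifP.
have memH Q : Q \in Qs -> (x \in Q) || (y \in Q) -> Q :\ w Q \in H.
  move=> QQs xyQ; rewrite inE; apply: (map_f trim).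
  by rewrite mem_filter /hits xyQ.
have hH E : E \in H -> #|E| = k.-1 /\ x \notin E.
  rewrite inE => /mapP[Q]; rewrite mem_filter => /andP[xyQ QQs] ->; split.
    by rewrite -(uQ _ QQs) (cardsD1 (w Q) Q) wQ.
  by rewrite !inE /w; case: ifP; rewrite ?eqxx ?andbF.
have cH : #|H| < d.
  by apply: leq_ltn_trans cnt; rewrite cardsE -size_filter -(size_map trim) card_size.
have [B1 hB1] := bal x H hH cH.
(* Complementing keeps every edge halved, so [y] may be taken red. *)
have [B yB hB] : exists2 B : {set T}, y \in B &
    forall E, E \in H -> 2 * #|E :&: B| = k.-1.
  case yB1: (y \in B1); first by exists B1.
  exists (~: B1) => [|E EH]; first by rewrite inE yB1.
  have := hB1 _ EH; have [+ _] := hH _ EH; have := cardsID B1 E.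
  by rewrite setDE; clear; lia.
(* [A] contains all queries through [x] or [y]; the balls outside it are free to reach
   [#|R| = r]. *)
pose A := [set x; y] :|: cover H.
have cA : #|A| <= d * k + 2.
  have cC : #|cover H| <= d * k.
    apply: leq_trans (leq_card_cover _) _.
    apply: leq_trans (_ : \sum_(E in H) k <= _).
      by apply: leq_sum => E EH; have [-> _] := hH _ EH; apply: leq_pred.
    by rewrite sum_nat_const leq_mul2r ltnW ?orbT.
  rewrite cardsU cards2; move: cC; clear; case: (x != y); lia.
have [|||R ER cR] := @extend_coloring _ A (A :&: (x |: B)) r.
- exact: subsetIl.
- exact: leq_trans lr.
- by apply: leq_trans lT; rewrite leq_add2r.
have sR : A :&: (x |: B) \subset R by rewrite -ER subsetIl.
exists R; split=> //; first by rewrite (subsetP sR) // !inE eqxx.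
  by rewrite (subsetP sR) // !inE eqxx yB !orbT.
move=> Q QQs xyQ; have HQ := memH _ QQs xyQ; have wQQ := wQ _ xyQ.
have sQA : Q \subset A.
  apply/subsetP=> u uQ'; rewrite inE.
  have [->|ne] := eqVneq u (w Q); first by rewrite /w !inE; case: ifP;
    rewrite eqxx ?orbT.
  apply/orP; right; apply/bigcupP; exists (Q :\ w Q) => //.
  by rewrite !inE ne.
(* The ball [w Q] is red and so is half of the other [k - 1], in total [(k + 1)/2]. *)
have -> : Q :&: R = w Q |: ((Q :\ w Q) :&: B).
  rewrite -(setIidPl sQA) -setIA [A :&: R]setIC ER (setIidPl sQA) setIA.
  rewrite (setIidPl sQA); apply/setP=> u; rewrite !inE.
  have [->|ne] := eqVneq u (w Q); rewrite /= ?wQQ /=.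
    by rewrite /w; case: ifP; rewrite ?eqxx ?yB ?orbT.
  case: (u =P x) => //= ux; move: ne; rewrite ux /w.
  by case: ifP => //; rewrite eqxx.
rewrite cardsU1 !inE eqxx /=; have := hB _ HQ; move: ok; clear.
by move: #|_| => a; lia.
Qed.

(** A ball of degree below [d] could be recolored alone in some tie, so all degrees are at least
    [d]. *)
Lemma odd_even_bound k d (T : finType) (Qs : seq {set T}) :
  (forall Q, Q \in Qs -> #|Q| = k) -> odd k -> balanceable k.-1 d T ->
  even_forcing k Qs -> ~~ odd #|T| -> 2 * (d * k + 2) <= #|T| ->
  #|T| * d <= k * size Qs.
Proof.
move=> uQ ok bal forc eT lT; rewrite -(sum_degree_uniform uQ) -sum_nat_const.
apply: leq_sum => x _; rewrite leqNgt; apply/negP => dx.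
have [|||R [xR _ cR hR]] := @link_coloring k d T Qs x x #|T|./2 uQ ok bal.
- by rewrite (eq_count (a2 := fun Q : {set T} => x \in Q)) // => Q; rewrite orbb.
- by move: lT; clear; lia.
- by move: lT; clear; lia.
apply: (@even_not_removable _ _ _ R [set x] forc).
  by rewrite cR; move: eT; clear; lia.
by apply: removable_single => // Q QQs xQ; apply: hR; rewrite ?xQ.
Qed.

Lemma odd_degree_pair k d m (T : finType) (Qs : seq {set T}) x y :
  (forall Q, Q \in Qs -> #|Q| = k) -> odd k -> balanceable k.-1 d T ->
  odd_forcing k Qs -> #|T| = m.*2.+1 -> d * k + 2 <= m -> x != y ->
  d <= degree Qs x + degree Qs y.
Proof.
move=> uQ ok bal forc ET lm xy; rewrite leqNgt; apply/negP => dxy.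
have [|||R [xR yR cR hR]] := @link_coloring k d T Qs x y m.+1 uQ ok bal.
- apply: leq_ltn_trans dxy; rewrite /degree -count_predUI.
  by apply: leq_trans (leq_addr _ _); apply: sub_count => Q.
- exact: leqW.
- by rewrite ET; move: lm; clear; lia.
have [i hi] := odd_removable_common forc ET cR.
have rem u : u \in R -> u \in [set x; y] -> i = u.
  move=> uR uxy; apply/eqP; rewrite -in_set1; apply: hi.
  apply: removable_single => // Q QQs uQ'; apply: hR => //.
  by move: uxy uQ'; rewrite !inE => /orP[] /eqP -> ->; rewrite ?orbT.
move/eqP: xy; case; rewrite -(rem x) ?inE ?eqxx //.
by rewrite (rem y) ?inE ?eqxx ?orbT.
Qed.

Lemma odd_odd_bound k d m n (Qs : seq {set 'I_n}) :
  (forall Q, Q \in Qs -> #|Q| = k) -> odd k -> balanceable k.-1 d 'I_n ->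
  odd_forcing k Qs -> n = m.*2.+1 -> d * k + 2 <= m ->
  n * d <= 2 * k * size Qs.
Proof.
move=> uQ ok bal forc En lm; rewrite -mulnA -(sum_degree_uniform uQ).
(* Pairing each ball with its cyclic successor counts every degree twice and gives [n] pairs,
   although [n] is odd. *)
rewrite mul2n -addnn {2}(reindex_inj (@ordS_inj n)) /= -big_split /=.
rewrite -[n in n * d]card_ord -sum_nat_const; apply: leq_sum => x _.
apply: (odd_degree_pair uQ ok bal forc _ lm); first by rewrite card_ord.
apply/eqP => /(congr1 val) /=; have xn := ltn_ord x.
have [lt|ge] := ltnP x.+1 n; first by rewrite modn_small //; lia.
have -> : x.+1 = n by lia.
by rewrite modnn; lia.
Qed.

(** * The four parity cases together *)

Theorem theorem7 (k : nat) : 2 <= k ->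
  exists n0 : nat, forall n : nat, n0 <= n ->
  forall Qs : seq {set 'I_n},
    (forall Q, Q \in Qs -> #|Q| = k) ->
    cm_successful Qs ->
    if ~~ odd k then
      (if ~~ odd n then 2 * n <= (k + 1) * size Qs
       else (2 * n).-1 <= (k + 1) * size Qs)
    else
      (if ~~ odd n then n * dC k.-1 n.-1 <= k * size Qs
       else n.-1 * dC k.-1 n.-1 <= (2 * k) * size Qs).
Proof.
(* The term [4 * k] gives [2 * k <= n./2] for even [k]; the rest gives
   [dC k.-1 n.-1 * k + 2 <= n./2] for odd [k], through [dC_le]. With denominators cleared, the
   ceilings are automatic because [size Qs] is an integer. *)
move=> k2; exists (4 * k + 2 * (2 ^ (2 * k.-1) * k + 2) + 1) => n.
move: (2 ^ _) (@dC_le k.-1 n.-1) => K dle ln Qs uQ succ.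
have fe := successful_even_forcing uQ succ.
have fo := successful_odd_forcing uQ succ.
have En : odd n -> n = (n./2).*2.+1.
  by move=> on; rewrite -{1}(odd_double_half n) on.
have cn := card_ord n.
have kn : 2 * k <= n by move: ln; clear; nia.
case: ifP => [ek|/negbFE ok].
  case: ifP => [en|/negbFE on].
    by rewrite -{1}cn; apply: even_even_bound; rewrite ?cn // (leq_trans k2) //;
       move: kn; clear; lia.
  rewrite -{1}cn; apply: (@even_odd_bound k n./2) => //.
    by rewrite cn; apply: En.
  by move: ln; clear; nia.
(* An odd [k >= 2] is at least 3, so [k.-1] meets the lower bound required by [dC_le]. *)
have {}dle : dC k.-1 n.-1 <= K.
  by apply: dle; move: k2 ok kn; clear; lia.
have bal : balanceable k.-1 (dC k.-1 n.-1) 'I_n.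
  case: n {Qs uQ succ fe fo En cn} ln kn dle => [|n] ln kn dle.
    by move: k2 kn; clear; lia.
  by apply: dC_balanceable; move: ok k2; clear; lia.
have dk : dC k.-1 n.-1 * k <= K * k by rewrite leq_mul2r dle orbT.
case: ifP => [en|/negbFE on].
  rewrite -{1}cn; apply: odd_even_bound; rewrite ?cn //.
  by move: dk ln; move: (_ * k) (K * k) => a b; clear; lia.
apply: leq_trans (_ : n * dC k.-1 n.-1 <= _).
  by rewrite leq_mul2r leq_pred orbT.
apply: (@odd_odd_bound k _ n./2) => //; first exact: En.
by move: dk ln; move: (_ * k) (K * k) => a b; clear; lia.
Qed.
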